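(* Let $\beta>0$, let $x=(x_n)_{n\ge1}\in \ell^2(\mathbb{R})$ with $x_n\ge0$ for all $n$, and let $X=(X_n)_{n\ge1}$ be a weak solution of the inviscid dyadic system $$\dot X_n = k_{n-1}X_{n-1}^2-k_nX_nX_{n+1},\qquad X_n(0)=x_n,\qquad n\ge1,\ t\ge0,$$ with initial condition $x$. Then there exists a constant $c$ depending only on $\|x\|_{\ell^2}$ and $\beta$ such that for every positive, non-increasing sequence $(a_n)_{n\ge1}$ the following inequality holds: $$\mathcal{L}\{t>0 \mid X_n(t)>a_n\text{ for some }n\ge1\}\le c\sum_{n\ge1}\frac{1}{k_na_n^3}.$$ Moreover, the inequality holds with $c=2^{7+\beta}\|x\|_{\ell^2}^2$.
   Context: Conventions: $k_n=2^{\beta n}$ for $n\ge1$, $k_0=0$ and $X_0\equiv0$. A weak solution is a sequence $X=(X_n)_{n\ge1}$ of real-valued differentiable functions on $[0,\infty)$ satisfying the system (equations and initial conditions) for all $n\ge1$ and $t\ge0$. $\mathcal{L}$ denotes Lebesgue measure on $\mathbb{R}$. *)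

(* Defs.v *)
From HB Require Import structures.
From mathcomp Require Import all_boot all_order all_algebra.
From mathcomp Require Import all_classical all_reals all_analysis.
Import Order.TTheory GRing.Theory Num.Theory numFieldNormedType.Exports.

Set Implicit Arguments.
Unset Strict Implicit.
Unset Printing Implicit Defensive.

Local Open Scope classical_set_scope.
Local Open Scope ring_scope.

(** Sequences $(u_n)_{n\ge1}$ are functions on [nat]; their value at index [0]
    is irrelevant unless stated otherwise. *)

Definition dyadic_k (R : realType) (beta : R) (n : nat) : R :=
  if n is 0 then 0 else 2 `^ (beta * n%:R).

Definition sqr_sum (R : realType) (x : nat -> R) : \bar R :=
  (\sum_(1 <= n <oo) (x n ^+ 2)%:E)%E.

Definition in_l2 (R : realType) (x : nat -> R) : Prop := (sqr_sum x < +oo)%E.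

(** Meaningful only under [in_l2 x]: [fine] sends [+oo] to [0]. *)
Definition l2norm (R : realType) (x : nat -> R) : R :=
  Num.sqrt (fine (sqr_sum x)).

(** [f] is only considered on the half-line $[0,\infty)$: the derivative is
    two-sided at [t > 0] and one-sided (from the right) at [t = 0]. *)
Definition has_derivative_nonneg (R : realType) (f : R -> R) (t df : R) : Prop :=
  (f s - f t) / (s - t) @[s --> within [set s : R | 0 <= s] t^'] --> df.

Definition weak_solution (R : realType) (beta : R) (x : nat -> R)
    (X : nat -> R -> R) : Prop :=
  [/\ forall t : R, 0 <= t -> X 0%N t = 0,
      forall n, (1 <= n)%N -> X n 0 = x n
    & forall (n : nat) (t : R), (1 <= n)%N -> 0 <= t ->
        has_derivative_nonneg (X n) t
          (dyadic_k beta n.-1 * X n.-1 t ^+ 2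
           - dyadic_k beta n * X n t * X n.+1 t)].

(* Main.v *)
Require Import Defs.
From HB Require Import structures.
From mathcomp Require Import all_boot all_order all_algebra.
From mathcomp Require Import all_classical all_reals all_analysis.
From mathcomp Require Import lra ring.
Import Order.TTheory GRing.Theory Num.Theory numFieldNormedType.Exports.

Set Implicit Arguments.
Unset Strict Implicit.
Unset Printing Implicit Defensive.

Local Open Scope classical_set_scope.
Local Open Scope ring_scope.

(** Write [E_n] for the sum of the [X_i ^ 2] over [i <= n]. A solution starting
    from nonnegative data stays nonnegative, because [X_n] satisfies a linear
    differential inequality; telescoping then gives
    [E_n' = - 2 k_n X_n^2 X_{n+1} <= 0], so [E_n] is nonincreasing and lies
    between [0] and the squared l2 norm [M] of the initial datum. The energy
    that leaves the first [n] modes between times [s] and [t] is exactly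
    [E_n s - E_n t].

    The key fact ([energy_drop]) is that a large last mode has to discharge
    quickly: if [X_m t > a] while [X_{m+1} t] and [X_{m+2} t] are at most [a],
    then [E_m] loses at least [3/4 a^2] in the time
    [tau = 48 * 2^beta / (k_m a)] following [t]. Suppose that it loses less.
    Then [X_m] stays above [a/2], and the modes [m+1], [m+2], which receive
    energy only from below, stay below [2 a]. The forcing [k_m X_m^2] of
    [X_{m+1}] is then of order [k_m a^2], while the energy loss bounds the time
    integral of [X_{m+1}], hence the total damping of [X_{m+1}]; so [X_{m+1}]
    outgrows [2 a] before [t + tau], a contradiction.

    Let now [X_n t > a_n]. Since the modes at time [t] are square summable there
    is a last index [m >= n] with [X_m t > a_n] ([last_large_mode]), and the
    key fact applies at [m] with [a = a_n]. As [a_m <= a_n], the time [t]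
    belongs to the set of times at which [E_m] is about to lose [3/4 a_m^2]
    within [48 * 2^beta / (k_m a_m)]. A nonincreasing function with values in
    [[0, M]] can be about to lose [d] within a time [tau] only on a set of
    measure at most [2 M tau / d] ([lebesgue_measure_drop]), which here is
    exactly [2^(7 + beta) M / (k_m a_m^3)]. Summing over [m] gives the
    theorem. *)

(** * Derivatives on the half-line *)
Lemma is_derive_quotient (R : realType) (g : R -> R) (t v : R) :
  (g s - g t) / (s - t) @[s --> t^'] --> v -> is_derive t 1 g v.
Proof.
move=> gv.
have gcv : h^-1 *: ((g \o shift t) (h *: (1 : R)) - g t) @[h --> 0^'] --> v.
  apply/cvgrPdist_le => e e0.
  move/cvgrPdist_le : gv => /(_ e e0).
  rewrite /at_right /dnbhs !near_withinE.
  move=> /nbhs_ballP[d /= d0 dP].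
  apply/nbhs_ballP; exists d => //= h; rewrite /ball/= sub0r normrN => hd h0.
  have := dP (h + t); rewrite /ball /= opprD addrCA subrr addr0 normrN.
  rewrite -subr_eq0 addrK => /(_ hd h0).
  by rewrite scaler1 /GRing.scale /= mulrC.
split; first by apply/cvg_ex; exists v.
exact: cvg_lim.
Qed.

(** Prolonging [f] by its tangent line at [0] turns one-sided differentiability
    on the half-line into two-sided differentiability there, so that the usual
    rules of calculus apply at all nonnegative times. *)
Lemma derivative_extension (R : realType) (f df : R -> R) :
  (forall t : R, 0 <= t -> has_derivative_nonneg f t (df t)) ->
  exists2 g : R -> R, (forall t, 0 <= t -> g t = f t) &
    forall t : R, 0 <= t -> is_derive t 1 g (df t).
Proof.
move=> fdf.
exists (fun t => if 0 <= t then f t else f 0 + df 0 * t).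
  by move=> t ->.
move=> t t0; apply: is_derive_quotient; apply/cvgrPdist_le => e e0; rewrite t0.
have /cvgrPdist_le/(_ e e0) := fdf t t0.
rewrite !near_withinE => ft.
move: t0; rewrite le_eqVlt => /predU1P[t0|t0].
  subst t.
  near=> s => sn0.
  case: ifPn => s0; first by apply: (near ft s).
  rewrite [f 0 + _]addrC addrK subr0 mulfK ?subrr ?normr0 ?ltW //.
have sp : \forall s \near t, 0 < s by exact: lt_nbhsr.
near=> s => sn0.
have s0 : 0 <= s by apply: ltW; near: s.
rewrite s0.
by apply: (near ft s).
Unshelve. all: by end_near.
Qed.

Lemma ler_derive (R : realType) (f df : R -> R) (s t : R) : s <= t ->
  (forall u : R, s <= u <= t -> is_derive u 1 f (df u)) ->
  (forall u, s <= u <= t -> 0 <= df u) -> f s <= f t.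
Proof.
move=> st fdf df0.
have fc : {within `[s, t], continuous f}.
  by apply: derivable_within_continuous => u; rewrite in_itv /= => /fdf[].
have [|c cst E] := @MVT_segment R f df s t st _ fc.
  by move=> c; rewrite in_itv/= => /andP[/ltW sc /ltW ct]; apply: fdf; rewrite sc.
rewrite -subr_ge0 E mulr_ge0 ?subr_ge0 // df0 //.
Qed.

Lemma derive_le0_left_min (R : realType) (w : R -> R) (t D : R) : 0 < t ->
  is_derive t 1 w D -> (forall s, 0 <= s <= t -> w t <= w s) -> D <= 0.
Proof.
move=> t0 wD wmin; rewrite leNgt; apply/negP => D0.
have wcv : h^-1 *: ((w \o shift t) (h *: (1 : R)) - w t) @[h --> 0^'] --> D.
  by case: wD => wt <-.
have : \forall h \near 0^', 0 < h^-1 *: ((w \o shift t) (h *: (1 : R)) - w t).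
  exact: (cvgr_gt D wcv).
rewrite near_withinE.
move=> /nbhs_ballP[d /= d0 dP].
pose h := - (Num.min (d / 2) t).
have h0 : h < 0 by rewrite oppr_lt0 lt_min t0 divr_gt0.
have hd : `|0 - h| < d.
  rewrite sub0r opprK gtr0_norm ?lt_min ?t0 ?divr_gt0 //.
  by rewrite gt_min ltr_pdivrMr // mulr_natr mulr2n ltrDl d0.
have ht : - h <= t by rewrite opprK ge_min lexx orbT.
have := dP h hd (ltr0_neq0 h0).
rewrite /= scaler1 /GRing.scale /= nmulr_rgt0 ?invr_lt0 // subr_lt0 ltNge.
move=> /negP; apply; apply: wmin; apply/andP; split; lra.
Qed.

(** Once multiplied by [expR (- Q t)], with [Q] larger than [- q] on [[0, T]],
    the function [f] has a positive derivative wherever it is negative, hence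
    cannot reach a negative minimum at a positive time. *)
Lemma comparison_ge0 (R : realType) (f df q : R -> R) (T : R) : 0 <= T ->
  (forall t : R, 0 <= t <= T -> is_derive t 1 f (df t)) ->
  {within `[0, T], continuous q} ->
  (forall t, 0 <= t <= T -> - (q t * f t) <= df t) ->
  0 <= f 0 -> 0 <= f T.
Proof.
move=> T0 fdf qc lb f0.
have [c cT qmin] := EVT_min T0 qc.
pose Q := 1 - q c.
pose w t := f t * expR (- Q * t).
have wd (t : R) : 0 <= t <= T ->
    is_derive t 1 w ((df t - Q * f t) * expR (- Q * t)).
  move=> tT; have ft := fdf t tT.
  have := is_deriveM ft (is_derive1_comp (is_derive_expR (- Q * t))
    (is_deriveZ (- Q) (is_derive_id t 1))).
  move/is_derive_eq; apply; rewrite /GRing.scale /=; ring.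
suff : 0 <= w T by rewrite pmulr_lge0 ?expR_gt0.
have wc : {within `[0, T], continuous w}.
  by apply: derivable_within_continuous => u; rewrite in_itv /= => /wd[].
have [m mT wmin] := EVT_min T0 wc.
apply: (le_trans _ (wmin T _)); last by rewrite in_itv/= T0 lexx.
have m0T : 0 <= m <= T by move: mT; rewrite in_itv.
rewrite leNgt; apply/negP => wm0.
have fm0 : f m < 0 by move: wm0; rewrite pmulr_llt0 ?expR_gt0.
have m0 : 0 < m.
  rewrite lt_neqAle; case/andP: m0T => -> _; rewrite andbT.
  by apply: contraTneq fm0 => <-; rewrite -leNgt.
have wdm := derive_le0_left_min m0 (wd m m0T).
have : (df m - Q * f m) * expR (- Q * m) <= 0.
  apply: wdm => s /andP[s0 sm]; apply: wmin.
  by rewrite in_itv /= s0 (le_trans sm) //; case/andP: m0T.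
rewrite pmulr_lle0 ?expR_gt0 // => dm.
have := lb m m0T; have := qmin m mT; rewrite /Q in dm => qm lbm.
have : 0 < (1 + (q m - q c)) * - f m by rewrite mulr_gt0 ?oppr_gt0 //; lra.
lra.
Qed.

(** * Energy balance of the dyadic system *)

(** The dyadic system with arbitrary nonnegative coefficients. Since [k 0 = 0],
    the equation also makes sense for the null mode [0] (where [n.-1 = n]),
    which spares a special case for [n = 1] throughout. *)
Record dyadic_flow (R : realType) (k : nat -> R) (Y : nat -> R -> R) : Prop :=
  DyadicFlow {
    flow_k0 : k 0%N = 0 ;
    flow_k_ge0 : forall n, 0 <= k n ;
    flow_0 : forall t, 0 <= t -> Y 0%N t = 0 ;
    flow_init : forall n, 0 <= Y n 0 ;
    flow_deriv : forall n (t : R), 0 <= t -> is_derive t 1 (Y n)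
      (k n.-1 * Y n.-1 t ^+ 2 - k n * Y n t * Y n.+1 t) }.

Definition energy (R : realType) (Y : nat -> R -> R) (n : nat) (t : R) : R :=
  \sum_(i < n.+1) Y i t ^+ 2.

Lemma energyS (R : realType) (Y : nat -> R -> R) n t :
  energy Y n.+1 t = energy Y n t + Y n.+1 t ^+ 2.
Proof. by rewrite /energy big_ord_recr. Qed.

Lemma energy_ge0 (R : realType) (Y : nat -> R -> R) n t : 0 <= energy Y n t.
Proof. by rewrite sumr_ge0 // => i _; rewrite sqr_ge0. Qed.

(** The gain term of the equation is nonnegative and the loss term is linear in
    [Y n], with continuous coefficient [k n * Y n.+1]. *)
Lemma flow_ge0 (R : realType) (k : nat -> R) (Y : nat -> R -> R) n t :
  dyadic_flow k Y -> 0 <= t -> 0 <= Y n t.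
Proof.
move=> YF t0.
apply: (@comparison_ge0 R (Y n)
  (fun t => k n.-1 * Y n.-1 t ^+ 2 - k n * Y n t * Y n.+1 t)
  (fun t => k n * Y n.+1 t) t t0).
- by move=> u /andP[u0 _]; exact: (flow_deriv YF).
- have kYd u : u \in `[0, t] -> derivable (k n \*: Y n.+1) u 1.
    rewrite in_itv /= => /andP[u0 _].
    by have [] := is_deriveZ (k n) (flow_deriv YF n.+1 u0).
  exact: derivable_within_continuous kYd.
- move=> u _.
  have := mulr_ge0 (flow_k_ge0 YF n.-1) (sqr_ge0 (Y n.-1 u)); lra.
- exact: (flow_init YF).
Qed.

(** The exchange terms between consecutive modes cancel, and only the flux out
    of mode [n] survives. *)
Lemma is_derive_energy (R : realType) (k : nat -> R) (Y : nat -> R -> R) n (t : R) :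
  dyadic_flow k Y -> 0 <= t ->
  is_derive t 1 (energy Y n) (- (2 * k n * Y n t ^+ 2 * Y n.+1 t)).
Proof.
move=> YF t0; elim: n => [|n IH].
  have -> : energy Y 0 = Y 0%N ^+ 2.
    by apply/funext => s; rewrite /energy big_ord1.
  apply: (is_derive_eq (is_deriveX 2 (flow_deriv YF 0 t0))).
  by rewrite (flow_k0 YF) (flow_0 YF t0) /GRing.scale /=; ring.
have -> : energy Y n.+1 = energy Y n + Y n.+1 ^+ 2.
  by apply/funext => s; rewrite energyS.
apply: (is_derive_eq (is_deriveD IH (is_deriveX 2 (flow_deriv YF n.+1 t0)))).
by rewrite /GRing.scale /=; ring.
Qed.

Lemma energy_noninc (R : realType) (k : nat -> R) (Y : nat -> R -> R) n s t :
  dyadic_flow k Y -> 0 <= s -> s <= t -> energy Y n t <= energy Y n s.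
Proof.
move=> YF s0 st; rewrite -lerN2.
apply: (@ler_derive R (- energy Y n)
  (fun u => 2 * k n * Y n u ^+ 2 * Y n.+1 u) s t st) => u /andP[su _].
  have := is_deriveN (is_derive_energy n YF (le_trans s0 su)).
  by move/is_derive_eq; apply; rewrite opprK.
have u0 := le_trans s0 su.
by rewrite !mulr_ge0 ?sqr_ge0 ?(flow_k_ge0 YF) ?(flow_ge0 _ YF).
Qed.

(** A mode that is large while the next two are not must pass a fixed fraction
    of its energy on within a time of order [1 / (k m * a)]. If it did not, the
    function [G] of the proof, which is [Y m.+1] corrected by a linear term
    (the gain from mode [m]) and by a multiple of the energy (which pays for
    the loss to mode [m.+2]), would be nondecreasing, and would force
    [Y m.+1] to exceed [2 * a]. *)
Lemma energy_drop (R : realType) (k : nat -> R) (Y : nat -> R -> R) (q a : R) m t :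
  dyadic_flow k Y -> 1 <= q -> 0 < k m -> k m.+1 = q * k m -> 0 < a ->
  (1 <= m)%N -> 0 <= t -> a < Y m t -> Y m.+1 t <= a -> Y m.+2 t <= a ->
  3 / 4 * a ^+ 2 <= energy Y m t - energy Y m (t + 48 * q / (k m * a)).
Proof.
move=> YF q1 km kq a0 m1 t0 aY Y1 Y2; rewrite leNgt; apply/negP.
set tau := 48 * q / _ => drop.
have tau0 : 0 < tau by rewrite divr_gt0 ?mulr_gt0 //; lra.
have ktau : k m * a ^+ 2 / 4 * tau = 12 * (q * a) by rewrite /tau; field; lra.
move: tau tau0 ktau drop => tau tau0 ktau drop.
have Y0 n u : t <= u -> 0 <= Y n u.
  by move=> tu; rewrite (flow_ge0 _ YF) // (le_trans t0).
have En n u v : t <= u -> u <= v -> energy Y n v <= energy Y n u.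
  by move=> tu uv; apply: (energy_noninc _ YF) => //; apply: le_trans tu.
have drop' u : t <= u <= t + tau -> energy Y m t - energy Y m u < 3 / 4 * a ^+ 2.
  move=> /andP[tu ut]; have := En m _ _ tu ut; lra.
(* Mode [m] receives energy only from the lower modes, whose energy is
   nonincreasing, so it loses at most what leaves the modes up to [m]. *)
have Ym u : t <= u <= t + tau -> a ^+ 2 / 4 <= Y m u ^+ 2.
  move=> utau; have := drop' u utau; case/andP: utau => tu _.
  case: m m1 {km kq Y1 Y2 drop drop' tau tau0 ktau} aY => // m _ aY.
  rewrite !energyS => D; have := En m _ _ (lexx t) tu.
  have : a ^+ 2 < Y m.+1 t ^+ 2 by rewrite ltr_pXn2r ?nnegrE ?Y0 // ltW.
  lra.
(* Modes [m.+1] and [m.+2] gain at most what leaves the modes up to [m]; the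
   total is at most [a^2 + a^2 + 3/4 a^2]. *)
have Yhigh u : t <= u <= t + tau -> Y m.+1 u ^+ 2 + Y m.+2 u ^+ 2 <= 4 * a ^+ 2.
  move=> utau; have := drop' u utau; case/andP: utau => tu _.
  have := En m.+2 _ _ (lexx t) tu; rewrite !energyS.
  have sq n : Y n t <= a -> Y n t ^+ 2 <= a ^+ 2.
    by move=> ?; rewrite ler_pXn2r ?nnegrE ?Y0 // ltW.
  have := sq _ Y1; have := sq _ Y2; have := sqr_ge0 a; lra.
have Ybnd u : t <= u <= t + tau -> Y m.+1 u <= 2 * a /\ Y m.+2 u <= 2 * a.
  move=> utau; have := Yhigh u utau.
  have := sqr_ge0 (Y m.+1 u); have := sqr_ge0 (Y m.+2 u) => ? ? ?.
  have e : (2 * a) ^+ 2 = 4 * a ^+ 2 by ring.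
  by split; rewrite -(@ler_pXn2r _ 2) ?nnegrE ?Y0 ?e //; (try lra); case/andP: utau.
(* On the interval, [k m * a ^+ 2 / 2 * Y m.+1] is at most minus the derivative
   of the energy, and the loss term of [Y m.+1] is at most
   [2 * a * q * k m * Y m.+1]: the ratio of the two is [c]. *)
pose c := 4 * q / a.
have c0 : 0 < c by rewrite divr_gt0 // mulr_gt0 //; lra.
pose G := Y m.+1 - (k m * a ^+ 2 / 4 \*: id) - (c \*: energy Y m).
have tt : t <= t + tau by rewrite lerDl ltW.
have : G t <= G (t + tau).
  apply: (@ler_derive R G (fun u =>
    (k m * Y m u ^+ 2 - k m.+1 * Y m.+1 u * Y m.+2 u)
    - k m * a ^+ 2 / 4 + c * (2 * k m * Y m u ^+ 2 * Y m.+1 u)) _ _ tt) => u tu.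
    have u0 : 0 <= u by case/andP: tu => /(le_trans t0).
    have := is_deriveB (is_deriveB (flow_deriv YF m.+1 u0)
      (is_deriveZ (k m * a ^+ 2 / 4) (is_derive_id u 1)))
      (is_deriveZ c (is_derive_energy m YF u0)).
    by move/is_derive_eq; apply; rewrite /GRing.scale /=; ring.
  have Y1u : 0 <= Y m.+1 u by apply: Y0; case/andP: tu.
  have [_ Y2u] := Ybnd u tu.
  have Ymu := Ym u tu.
  have h1 : 0 <= k m * (Y m u ^+ 2 - a ^+ 2 / 4) by rewrite mulr_ge0 ?subr_ge0 // ltW.
  have h2 : k m.+1 * Y m.+1 u * Y m.+2 u <= q * k m * Y m.+1 u * (2 * a).
    rewrite kq ler_wpM2l // !mulr_ge0 //; lra.
  have h3 : c * (2 * k m * (a ^+ 2 / 4) * Y m.+1 u) <= c * (2 * k m * Y m u ^+ 2 * Y m.+1 u).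
    rewrite ler_wpM2l ?(ltW c0) // ler_wpM2r // ler_wpM2l // mulr_ge0 //; lra.
  have h4 : c * (2 * k m * (a ^+ 2 / 4) * Y m.+1 u) = q * k m * Y m.+1 u * (2 * a).
    rewrite /c; field; lra.
  lra.
have [Yend _] : Y m.+1 (t + tau) <= 2 * a /\ Y m.+2 (t + tau) <= 2 * a.
  by apply: Ybnd; rewrite tt lexx.
have Yt0 := Y0 m.+1 t (lexx t).
have -> : G (t + tau) = Y m.+1 (t + tau) - k m * a ^+ 2 / 4 * (t + tau)
  - c * energy Y m (t + tau) by [].
have -> : G t = Y m.+1 t - k m * a ^+ 2 / 4 * t - c * energy Y m t by [].
have cE : c * (energy Y m t - energy Y m (t + tau)) <= 3 * (q * a).
  have -> : 3 * (q * a) = c * (3 / 4 * a ^+ 2) by rewrite /c; field; lra.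
  by rewrite ler_wpM2l ?ltW.
(* The gain [12 * (q * a)] exceeds the loss [3 * (q * a)] by more than
   [2 * a]. *)
have : a <= q * a by rewrite ler_peMl // ltW.
lra.
Qed.

(** * Measure of the set of times preceding a drop *)

(** Countable subadditivity holds for arbitrary sets because
    [lebesgue_measure] coincides, on all of them, with the outer measure it is
    built from. *)
Lemma lebesgue_measure_cover (R : realType) (A : set R) (F : nat -> set R) :
  A `<=` \bigcup_n F n ->
  (lebesgue_measure A <= \sum_(n <oo) lebesgue_measure (F n))%E.
Proof.
move=> AF.
have -> : @lebesgue_measure R = ((wlength idfun)^*)%mu :> (set R -> \bar R) by [].
apply: le_trans (le_outer_measure ((wlength idfun)^*)%mu _ _ AF) _.
exact: (outer_measure_sigma_subadditive ((wlength idfun)^*)%mu).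
Qed.

Lemma sum_two_step_drops (R : realType) (u : nat -> R) n :
  \sum_(0 <= i < n) (u i - u i.+2) = u 0%N + u 1%N - (u n + u n.+1).
Proof.
elim: n => [|n IH]; first by rewrite big_geq // subrr.
by rewrite big_nat_recr //= IH; ring.
Qed.

(** Cut the half-line into intervals of length [tau]. If the [j]-th one meets the
    set, then [g] drops by at least [d] over the union of the intervals [j] and
    [j + 1]. Every interval belongs to two such unions, hence the factor 2. *)
Lemma lebesgue_measure_drop (R : realType) (g : R -> R) (M d tau : R) :
  0 < d -> 0 < tau ->
  (forall s t, 0 <= s -> s <= t -> g t <= g s) ->
  (forall t, 0 <= t -> 0 <= g t) -> g 0 <= M ->
  (lebesgue_measure [set t : R | (0 <= t)%R /\ (d <= g t - g (t + tau))%R]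
    <= (2 * M * tau / d)%:E)%E.
Proof.
move=> d0 tau0 gdec g0 gM.
pose u (j : nat) := g (j%:R * tau).
have j0 (j : nat) : 0 <= j%:R * tau :> R by rewrite mulr_ge0 // ltW.
have jS (j : nat) : j.+1%:R * tau = j%:R * tau + tau by rewrite -addn1 natrD; ring.
have uS (j : nat) : u j.+1 <= u j.
  by apply: gdec => //; rewrite jS lerDl ltW.
pose F (j : nat) : set R :=
  if d <= u j - u j.+2 then `[j%:R * tau, j.+1%:R * tau]%classic else set0.
apply: (le_trans (@lebesgue_measure_cover R _ F _)).
  move=> t [t0 dt]; have tt0 : 0 <= t / tau by rewrite divr_ge0 // ltW.
  have /andP[jt tj] := truncn_itv tt0.
  move: jt tj; set j := Num.truncn _; rewrite ler_pdivlMr // ltr_pdivrMr // => jt tj.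
  exists j => //; rewrite /F ifT; first by rewrite /= in_itv /= jt ltW.
  apply: (le_trans dt); rewrite lerB //; apply: gdec => //.
    by rewrite addr_ge0 // ltW.
  by rewrite jS lerD2r ltW.
have Fle j : (lebesgue_measure (F j) <= (tau / d * (u j - u j.+2))%:E)%E.
  rewrite /F; case: ifPn => [dj|_]; last first.
    have udec : u j.+2 <= u j := le_trans (uS _) (uS _).
    by rewrite measure0 lee_fin mulr_ge0 ?subr_ge0 ?divr_ge0 // ltW.
  rewrite lebesgue_measure_itv /= lte_fin jS ltrDl tau0 -EFinD lee_fin.
  by rewrite [_ + tau]addrC addrK mulrAC ler_pdivlMr // ler_pM2l.
apply: lime_le; first by apply: is_cvg_nneseries => i _ _; exact: measure_ge0.
apply: nearW => n; apply: (le_trans (lee_sum _ (fun i _ => Fle i))).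
rewrite sumEFin lee_fin -mulr_sumr sum_two_step_drops.
rewrite -[2 * M * tau / d]mulrA mulrC ler_pM2r ?divr_gt0 //.
have u1 : u 1%N <= M by apply: le_trans (uS 0%N) _; rewrite /u mul0r.
have u0M : u 0%N <= M by rewrite /u mul0r.
have := g0 _ (j0 n); have := g0 _ (j0 n.+1); rewrite -/(u n) -/(u n.+1); lra.
Qed.

(** * Times at which some mode is large *)

Lemma last_large_mode (R : realType) (y : nat -> R) (M a : R) n :
  (forall N, \sum_(i < N.+1) y i ^+ 2 <= M) -> (forall i, 0 <= y i) -> 0 < a ->
  a < y n -> exists m, [/\ (n <= m)%N, a < y m & forall j, (m < j)%N -> y j <= a].
Proof.
move=> yM y0 a0 an.
have ycvg : cvgn (series (fun i => y i ^+ 2)).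
  apply: nondecreasing_is_cvgn.
    apply/nondecreasing_seqP => N.
    by rewrite /series /= big_nat_recr //= lerDl sqr_ge0.
  (* [series] sums over [i < N], the hypothesis over [i <= N]. *)
  exists M => _ [N _ <-]; rewrite /series /= big_mkord.
  by apply: le_trans (yM N); rewrite big_ord_recr /= lerDl sqr_ge0.
have ylim := cvg_series_cvg_0 ycvg.
have : \forall i \near \oo, y i ^+ 2 < a ^+ 2.
  by apply: (cvgr_lt 0 ylim); rewrite exprn_gt0.
move=> [N _ NP].
have ub j : a < y j -> (j <= N)%N.
  move=> aj; rewrite leqNgt; apply/negP => /ltnW /NP /=.
  by rewrite ltr_pXn2r ?nnegrE ?(ltW a0) // => /ltW; rewrite leNgt aj.
have exP : exists j, a < y j by exists n.
have [m am mmax] := ex_maxnP exP ub.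
exists m; split => //; first exact: mmax.
by move=> j mj; rewrite leNgt; apply/negP => /mmax; rewrite leqNgt mj.
Qed.

Lemma weak_solution_flow (R : realType) (beta : R) (x : nat -> R)
    (X : nat -> R -> R) :
  (forall n, (1 <= n)%N -> 0 <= x n) -> weak_solution beta x X ->
  exists2 Y : nat -> R -> R, dyadic_flow (dyadic_k beta) Y &
    forall n t, 0 <= t -> Y n t = X n t.
Proof.
move=> x0 [X0 Xi Xd].
pose rhs n t := dyadic_k beta n.-1 * X n.-1 t ^+ 2 - dyadic_k beta n * X n t * X n.+1 t.
have /choice[Y YP] : forall n, exists g : R -> R, (forall t : R, 0 <= t -> g t = X n t) /\
    forall t : R, 0 <= t -> is_derive t 1 g (rhs n t).
  case=> [|n].
    exists (fun=> 0); split=> [t /X0 -> //|t _].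
    apply: (is_derive_eq (is_derive_cst (0 : R) t 1)).
    by rewrite /rhs /= !mul0r subrr.
  by have [g gX gd] := derivative_extension (Xd n.+1^~ isT); exists g.
have YX n t : 0 <= t -> Y n t = X n t by move=> t0; rewrite (YP n).1.
exists Y => //; split=> //.
- by case=> [|n] //=; rewrite powR_ge0.
- by move=> t t0; rewrite YX ?X0.
- by case=> [|n]; rewrite YX ?X0 // Xi // x0.
- by move=> n t t0; rewrite !YX //; exact: (YP n).2.
Qed.

Lemma l2norm_sqr (R : realType) (x : nat -> R) : in_l2 x ->
  (l2norm x ^+ 2)%:E = sqr_sum x.
Proof.
rewrite /in_l2 => xoo.
have x0 : (0 <= sqr_sum x)%E.
  by apply: nneseries_ge0 => n _ _; rewrite lee_fin sqr_ge0.
by rewrite /l2norm sqr_sqrtr ?fine_ge0 // fineK // ge0_fin_numE.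
Qed.

Lemma initial_energy (R : realType) (beta : R) (x : nat -> R)
    (X : nat -> R -> R) N : in_l2 x -> weak_solution beta x X ->
  energy X N 0 <= l2norm x ^+ 2.
Proof.
move=> xl2 [X0 Xi _]; rewrite -lee_fin l2norm_sqr //.
rewrite /energy -(big_mkord xpredT (fun i => X i 0 ^+ 2)) big_ltn // X0 //.
rewrite expr0n add0r -sumEFin.
rewrite (eq_big_nat _ _ (F2 := fun i => (x i ^+ 2)%:E)); last first.
  by move=> i /andP[i1 _]; rewrite Xi.
by apply: nneseries_lim_ge => i _ _; rewrite lee_fin sqr_ge0.
Qed.

Lemma dyadic_kS (R : realType) (beta : R) n : (1 <= n)%N ->
  dyadic_k beta n.+1 = 2 `^ beta * dyadic_k beta n.
Proof.
case: n => // n _; rewrite /dyadic_k -powRD; last by rewrite pnatr_eq0 implybT.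
by congr (_ `^ _); rewrite -[n.+2]addn1 natrD; ring.
Qed.

Lemma dyadic_k_gt0 (R : realType) (beta : R) n : (1 <= n)%N -> 0 < dyadic_k beta n.
Proof. by case: n => // n _; rewrite powR_gt0. Qed.

(** The set is covered by the sets [F m] of times at which the energy of the
    first [m] modes is about to drop by [3/4 * a m ^+ 2]. *)
Lemma measure_large_modes (R : realType) (beta : R) (x : nat -> R)
    (X : nat -> R -> R) (a : nat -> R) :
  0 < beta -> in_l2 x -> (forall n, (1 <= n)%N -> 0 <= x n) ->
  weak_solution beta x X ->
  (forall n, (1 <= n)%N -> 0 < a n) ->
  (forall m n, (1 <= m)%N -> (m <= n)%N -> a n <= a m) ->
  (lebesgue_measure
     [set t : R | (0 < t)%R /\ exists n, (1 <= n)%N /\ (a n < X n t)%R]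
   <= (2 `^ (7 + beta) * l2norm x ^+ 2)%R%:E
      * \sum_(1 <= n <oo) (1 / (dyadic_k beta n * a n ^+ 3))%R%:E)%E.
Proof.
move=> beta0 xl2 x0 WX a0 adec.
have [Y YF YX] := weak_solution_flow x0 WX.
set M := l2norm x ^+ 2; set k := dyadic_k beta; pose q : R := 2 `^ beta.
have YM N t : 0 <= t -> energy Y N t <= M.
  move=> t0; apply: le_trans (energy_noninc N YF (lexx 0) t0) _.
  rewrite (_ : energy Y N 0 = energy X N 0) ?(initial_energy N xl2 WX) //.
  by apply: eq_bigr => i _; rewrite YX.
have q1 : 1 <= q by rewrite -[1](powRr0 2) ler_powR ?ltW // ltr1n.
have k0 n : (1 <= n)%N -> 0 < k n by exact: dyadic_k_gt0.
pose tau n := 48 * q / (k n * a n).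
pose F n : set R := if n is 0 then set0 else
  [set t | 0 <= t /\ 3 / 4 * a n ^+ 2 <= energy Y n t - energy Y n (t + tau n)].
apply: (le_trans (@lebesgue_measure_cover R _ F _)).
  move=> t /= [/ltW t0 [n [n1]]]; rewrite -YX // => an.
  (* The last mode above the level [a n], not the last mode above its own
     level: as the sequence [a] may tend to 0, the latter need not exist. *)
  have [m [nm am mmax]] := last_large_mode (fun N => YM N t t0)
    (fun i => flow_ge0 i YF t0) (a0 n n1) an.
  have m1 := leq_trans n1 nm.
  have amn : a m <= a n by exact: adec.
  exists m => //; rewrite /F; case: m m1 {nm} am mmax amn => // m m1 am mmax amn.
  split=> //.
  have /(_ (mmax _ _) (mmax _ _)) := energy_drop YF q1 (k0 _ m1)
    (dyadic_kS beta m1) (a0 n n1) m1 t0 am.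
  move=> /(_ (ltnSn _) (ltnW (ltnSn _))) D.
  have am0 := a0 _ m1; have an0 := a0 _ n1; have km0 := k0 _ m1.
  (* The drop is known for the level [a n]. Passing to the level [a m <= a n]
     lowers the required drop and lengthens the time allowed for it. *)
  apply: le_trans (le_trans _ D) _.
    by rewrite ler_pM2l ?divr_gt0 // ler_pXn2r ?nnegrE ?(ltW am0) ?(ltW an0).
  rewrite lerB //; apply: (energy_noninc _ YF).
    by rewrite addr_ge0 // ltW // divr_gt0 ?mulr_gt0 //; lra.
  rewrite lerD2l ler_pM2l ?mulr_gt0 //; last by lra.
  by rewrite lef_pV2 ?posrE ?mulr_gt0 // ler_pM2l.
pose c := 2 `^ (7 + beta) * M.
have M0 : 0 <= M by rewrite sqr_ge0.
have c0 : 0 <= c by rewrite mulr_ge0 // powR_ge0.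
(* At [n = 0] the coefficient [k 0] vanishes, and so does its inverse. *)
have u0 n : (0 <= (1 / (k n * a n ^+ 3))%:E)%E.
  rewrite lee_fin; case: n => [|n]; first by rewrite /k /= mul0r invr0 mulr0.
  by rewrite divr_ge0 // mulr_ge0 ?exprn_ge0 ?ltW ?k0 ?a0.
have Fle n :
    (lebesgue_measure (F n) <= c%:E * (1 / (k n * a n ^+ 3))%:E)%E.
  case: n => [|n]; first by rewrite measure0; apply: mule_ge0 (u0 _).
  have an0 := a0 n.+1 isT; have kn0 := k0 n.+1 isT.
  apply: (le_trans (lebesgue_measure_drop (M := M) _ _ _ _ _)).
  - by rewrite mulr_gt0 ?divr_gt0 // exprn_gt0.
  - by rewrite divr_gt0 ?mulr_gt0 //; lra.
  - by move=> s t; apply: (energy_noninc _ YF).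
  - by move=> t _; exact: energy_ge0.
  - exact: YM.
  rewrite -EFinM lee_fin /c powRD; last by rewrite pnatr_eq0 implybT.
  rewrite -/q powR_mulrn // /tau le_eqVlt; apply/orP; left; apply/eqP.
  (* [2 * (48 * q / (k n * a n)) / (3 / 4 * a n ^+ 2)] is
     [2 ^+ 7 * q / (k n * a n ^+ 3)]. *)
  field; lra.
apply: lime_le; first by apply: is_cvg_nneseries => i _ _; exact: measure_ge0.
apply: nearW => n.
have -> : (\sum_(0 <= i < n) lebesgue_measure (F i) =
    \sum_(1 <= i < n) lebesgue_measure (F i))%E.
  by case: n => [|n]; [rewrite !big_geq|rewrite big_ltn // measure0 add0e].
apply: (le_trans (lee_sum _ (fun i _ => Fle i))).
rewrite -nneseriesZl //; apply: nneseries_lim_ge => i _ _.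
exact: mule_ge0.
Qed.

Theorem theorem10 (R : realType) :
  (exists c : R -> R -> R,
    forall (beta : R) (x : nat -> R) (X : nat -> R -> R),
      0 < beta -> in_l2 x -> (forall n, (1 <= n)%N -> 0 <= x n) ->
      weak_solution beta x X ->
      forall a : nat -> R,
        (forall n, (1 <= n)%N -> 0 < a n) ->
        (forall m n, (1 <= m)%N -> (m <= n)%N -> a n <= a m) ->
        (lebesgue_measure
           [set t : R | (0 < t)%R /\ exists n, (1 <= n)%N /\ (a n < X n t)%R]
         <= (c (l2norm x) beta)%:E
            * \sum_(1 <= n <oo) (1 / (dyadic_k beta n * a n ^+ 3))%R%:E)%E)
  /\
  (forall (beta : R) (x : nat -> R) (X : nat -> R -> R),
      0 < beta -> in_l2 x -> (forall n, (1 <= n)%N -> 0 <= x n) ->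
      weak_solution beta x X ->
      forall a : nat -> R,
        (forall n, (1 <= n)%N -> 0 < a n) ->
        (forall m n, (1 <= m)%N -> (m <= n)%N -> a n <= a m) ->
        (lebesgue_measure
           [set t : R | (0 < t)%R /\ exists n, (1 <= n)%N /\ (a n < X n t)%R]
         <= (2 `^ (7 + beta) * l2norm x ^+ 2)%R%:E
            * \sum_(1 <= n <oo) (1 / (dyadic_k beta n * a n ^+ 3))%R%:E)%E).
Proof.
split; last first.
  by move=> *; exact: measure_large_modes.
exists (fun norm beta => 2 `^ (7 + beta) * norm ^+ 2).
by move=> *; exact: measure_large_modes.
Qed.
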